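(* Let $\tau$ be an infinite regular cardinal and let $G$ be a group whose center has index $\le\tau$ in $G$. Then a set $A\subset G$ is $\tau$-algebraic in $G$ if and only if $A$ is unconditionally $\tau$-closed in $G$.
   Context: Let $G$ be a group with identity $1$ and $\tau$ a cardinal. A subset $A\subset G$ is elementary algebraic in $G$ if there is a word $w(x)$ in the alphabet $G\cup\{x^{\pm1}\}$ (i.e. an element $w(x)$ of the free product $G*\langle x\rangle$, $x$ a variable) such that $A=\{g\in G: w(g)=1\}$, where $w(g)$ is obtained by substituting $g$ for $x$. A subset of $G$ is $\tau$-additively algebraic if it can be represented as a union of fewer than $\tau$-many elementary algebraic sets. Arbitrary intersections of $\tau$-additively algebraic sets are called $\tau$-algebraic. A topology $\mathcal T$ is a $P_\tau$-topology if any intersection of fewer than $\tau$-many $\mathcal T$-open sets is $\mathcal T$-open. A subset $A$ of $G$ is unconditionally $\tau$-closed in $G$ if it is closed in every Hausdorff group $P_\tau$-topology on $G$ (a group topology is a topology making multiplication and inversion continuous). *)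

(* Defs.v *)
From HB Require Import structures.
From mathcomp Require Import all_boot.
From mathcomp Require Import all_classical.
From mathcomp Require Import topology.

Set Implicit Arguments.
Unset Strict Implicit.
Unset Printing Implicit Defensive.

Local Open Scope classical_set_scope.
Local Open Scope card_scope.
Local Open Scope group_scope.

(* A cardinal tau is represented by a type K of that cardinality, so that
   "fewer than tau many" is [card_lt _ [set: K]].  Families indexed by fewer
   than tau indices are represented by their sets of members. *)
Definition card_lt (T U : Type) (A : set T) (B : set U) : Prop :=
  A #<= B /\ ~ (B #<= A).

(* An infinite cardinal is regular if it is not a union of fewer than tau many
   sets, each of cardinality less than tau. *)
Definition infinite_regular (K : Type) : Prop :=
  infinite_set [set: K] /\
  forall F : set (set K), card_lt F [set: K] ->
    (forall B, F B -> card_lt B [set: K]) ->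
    \bigcup_(B in F) B <> [set: K].

Section Algebraic.
Variable G : groupType.

Definition group_center : set G := [set z | forall g : G, commute z g].

Definition center_cosets : set (set G) :=
  [set [set g * z | z in group_center] | g in [set: G]].

Inductive letter := Const of G | Var | VarInv.

Definition letter_subst (g : G) (l : letter) : G :=
  match l with Const a => a | Var => g | VarInv => g^-1 end.

(* The value w(g) depends only on the element of the free product of G and <x>
   spelled by the word w, so words and elements have the same solution sets. *)
Definition word_subst (w : seq letter) (g : G) : G :=
  \prod_(l <- w) letter_subst g l.

Definition elementary_algebraic (A : set G) : Prop :=
  exists w : seq letter, A = [set g | word_subst w g = 1].

Definition additively_algebraic (K : Type) (A : set G) : Prop :=
  exists F : set (set G), [/\ card_lt F [set: K],
    F `<=` elementary_algebraic & A = \bigcup_(B in F) B].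

Definition algebraic (K : Type) (A : set G) : Prop :=
  exists F : set (set G),
    F `<=` additively_algebraic K /\ A = \bigcap_(B in F) B.

End Algebraic.

Arguments group_center G : clear implicits.
Arguments center_cosets G : clear implicits.

Definition P_topology (K : Type) (X : topologicalType) : Prop :=
  forall F : set (set X), card_lt F [set: K] -> F `<=` open ->
    open (\bigcap_(B in F) B).

Section GroupTopology.
Variable G : groupType.

(* Quantifying over [Topological.axioms_ G], the class of topological structures
   on the carrier of G, ranges over all topologies on G.  Such a class carries
   its own choice operator, which plays no role here. *)
Definition group_topology (t : Topological.axioms_ G) : Prop :=
  let X := Topological.Pack t in
  continuous ((fun p => (p.1 : G) * (p.2 : G)) : X * X -> X) /\
  continuous ((fun x => (x : G)^-1) : X -> X).

Definition unconditionally_closed (K : Type) (A : set G) : Prop :=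
  forall t : Topological.axioms_ G,
    let X := Topological.Pack t in
    group_topology t -> hausdorff_space X -> P_topology K X ->
    closed (A : set X).

End GroupTopology.

(* Main.v *)
(* A set that is not tau-algebraic misses a point g of its tau-Zariski closure,
   and it suffices to find a Hausdorff group P_tau-topology in which g is a limit
   of A.  Markov's method, carried to length tau: choose b_c in A (c < tau) so
   that a_c = g^-1 b_c satisfies no equation with earlier coefficients, of
   complexity bounded by c, that 1 does not satisfy.  By regularity there are
   fewer than tau such equations, so their solution sets translated by g do not
   cover A.  The finest group P_tau-topology with a_c -> 1 is then Hausdorff:
   in a product of conjugates of the a_c, the terms of highest index may be
   replaced by 1.  Since the center has index at most tau, only tau conjugations
   matter, although G itself may be larger than tau. *)
From HB Require Import structures.
Require Import Defs.
From mathcomp Require Import all_boot all_classical topology.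
From mathcomp Require Import wochoice.

Local Open Scope classical_set_scope.
Local Open Scope card_scope.
Local Open Scope group_scope.

Set Implicit Arguments.
Unset Strict Implicit.
Unset Printing Implicit Defensive.

(** * Comparison of cardinals *)

Lemma card_le_rel (T U : Type) (A : set T) (B : set U) (R : T -> U -> Prop) :
  (forall a, A a -> exists2 b, B b & R a b) ->
  (forall a a' b, R a b -> R a' b -> a = a') -> A #<= B.
Proof.
move=> totR injR; apply/card_leP/injfunPex.
have /choice[f fR] : forall a : A, exists b : B, R (val a) (val b).
  move=> [a /= aA]; have [b Bb Rab] := totR a (set_mem aA).
  by exists (SigSub (mem_set Bb)).
exists f => // a a' _ _ ff; apply: val_inj; apply: injR (fR a) _.
by rewrite ff.
Qed.

Lemma card_leT_inj (T U : Type) (A : set U) : [set: T] #<= A ->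
  exists2 f : T -> U, injective f & forall x, A (f x).
Proof.
move=> /card_leP/injfunPex[g _ ginj].
exists (fun x => val (g (SigSub (mem_set (Logic.I : [set: T] x))))) => [x y|x].
  move=> /val_inj /ginj; rewrite !inE => /(_ Logic.I Logic.I).
  by move=> /(congr1 val).
by apply: set_mem; apply: valP.
Qed.

(** Zorn's lemma gives a maximal partial injection [R]. If it missed both some [a0] in [A] and some
    [b] in [B], the pair [(a0, b)] could be added, so [R] or its converse is defined everywhere. *)
Lemma card_le_total (T U : Type) (A : set T) (B : set U) :
  A #<= B \/ B #<= A.
Proof.
pose partial_inj (R : set (T * U)) := [/\ R `<=` A `*` B,
  (forall a b b', R (a, b) -> R (a, b') -> b = b') &
  (forall a a' b, R (a, b) -> R (a', b) -> a = a')].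
have [F FP Ftot|R [[RAB funR injR] maxR]] := @Zorn_bigcup _ partial_inj.
  have joinF x y : (\bigcup_(X in F) X) x -> (\bigcup_(X in F) X) y ->
      exists X, [/\ F X, X x & X y].
    move=> [X FX Xx] [Y FY Yy]; have [XY|YX] := Ftot _ _ FX FY.
      by exists Y; split=> //; apply: XY.
    by exists X; split=> //; apply: YX.
  split=> [x [X /FP[XAB _ _] /XAB//]|a b b'|a a' b] /joinF jF /jF.
    by case=> X [/FP[_ + _]]; apply.
  by case=> X [/FP[_ _ +]]; apply.
have [domR|/existsNP[a0 /not_implyP[Aa0 a0R]]] :=
  pselect (forall a, A a -> exists b, R (a, b)).
  left; apply: (@card_le_rel _ _ _ _ (fun a b => R (a, b))) => //.
  by move=> a /domR[b Rab]; exists b => //; have [] := RAB _ Rab.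
right; apply: (@card_le_rel _ _ _ _ (fun b a => R (a, b))) => [b Bb|]; last first.
  by move=> b b' a; apply: funR.
apply: contrapT => bR.
have nRb a : ~ R (a, b) by move=> Rab; apply: bR; exists a => //; case: (RAB _ Rab).
have nRa b' : ~ R (a0, b') by move=> Rab; apply: a0R; exists b'.
apply: (maxR (R `|` [set (a0, b)])).
  by split=> [x|/(_ (a0, b) (or_intror erefl))/nRb//]; left.
split=> [_ [/RAB//|->//]|a b1 b2|a1 a2 b1].
- move=> [R1|[ea eb]] [R2|[ea' eb']]; first exact: funR R1 R2.
  + by case: (nRa b1); rewrite -ea'.
  + by case: (nRa b2); rewrite -ea.
  + by rewrite eb eb'.
- move=> [R1|[ea eb]] [R2|[ea' eb']]; first exact: injR R1 R2.
  + by case: (nRb a1); rewrite -eb'.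
  + by case: (nRb a2); rewrite -eb.
  + by rewrite ea ea'.
Qed.

(** * Order properties of well-orders *)

Section WellOrder.
Variables (T : eqType) (R : rel T) (woR : well_order R).

Lemma well_order_total : total R.
Proof.
move=> x y; have [|m [[+ minm] _]] := woR (A := [pred t | t \in [:: x; y]]).
  by exists x; rewrite !inE eqxx.
by rewrite !inE => /orP[] /eqP <-; rewrite (minm y, minm x) ?inE ?eqxx ?orbT.
Qed.

(** Least elements are unique, and points that precede each other are both least in the pair they
    form. *)
Lemma well_order_antisymmetric : antisymmetric R.
Proof.
move=> x y /andP[xy yx].
have [|m [_ minm]] := woR (A := [pred t | t \in [:: x; y]]).
  by exists x; rewrite !inE eqxx.
have refl z : R z z by rewrite -[R z z]orbb well_order_total.
rewrite -(minm x) ?(minm y) //; (split; first by rewrite !inE eqxx ?orbT).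
  by move=> z; rewrite !inE => /orP[] /eqP ->.
by move=> z; rewrite !inE => /orP[] /eqP ->.
Qed.

(** The least of the three points is [x], or else it closes a two-point cycle that antisymmetry
    collapses. *)
Lemma well_order_trans : transitive R.
Proof.
move=> y x z xy yz.
have [|m [[m3 minm] _]] := woR (A := [pred t | t \in [:: x; y; z]]).
  by exists x; rewrite !inE eqxx.
have [mx my mz] : [/\ R m x, R m y & R m z].
  by split; apply: minm; rewrite !inE eqxx ?orbT.
move: m3; rewrite !inE => /or3P[] /eqP me; move: mx my mz; rewrite me //.
  move=> yx _ _; rewrite (_ : x = y) //.
  by apply: well_order_antisymmetric; rewrite xy.
move=> _ zy _; rewrite (_ : z = y) //.
by apply: well_order_antisymmetric; rewrite zy.
Qed.

Lemma well_order_wf : well_founded (fun x y => ~~ R y x).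
Proof.
move=> x; apply: contrapT => accx.
have [|z [[/asboolP nz minz] _]] :=
    woR (A := [pred y | `[< ~ Acc (fun x y => ~~ R y x) y >]]).
  by exists x; apply/asboolP.
apply: nz; constructor => y; apply: contraNP => nAcc.
by apply: minz; apply/asboolP.
Qed.

End WellOrder.

(** * Sets of fewer than tau elements *)

Section Small.
Variables (K : Type) (regK : infinite_regular K).

(** Comparability of cardinals makes this the same as [card_lt A [set: K]]; the one-sided form
    passes directly to subsets and images. *)
Definition small (T : Type) (A : set T) : Prop := ~ ([set: K] #<= A).

Lemma small_card_lt (T : Type) (A : set T) : small A -> card_lt A [set: K].
Proof. by move=> smA; split=> //; case: (card_le_total A [set: K]). Qed.

Lemma card_le_small (T U : Type) (A : set T) (B : set U) :
  A #<= B -> small B -> small A.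
Proof. by move=> AB smB KA; apply: smB; apply: card_le_trans KA AB. Qed.

Lemma small_subset (T : Type) (A B : set T) : A `<=` B -> small B -> small A.
Proof. by move=> /subset_card_le; apply: card_le_small. Qed.

Lemma small_image (T U : Type) (f : T -> U) (A : set T) :
  small A -> small (f @` A).
Proof. exact: card_le_small (card_image_le _ _). Qed.

Lemma small_preimage (T U : Type) (f : T -> U) (A : set U) :
  injective f -> small A -> small (f @^-1` A).
Proof.
move=> injf; apply: card_le_small.
apply: (@card_le_rel _ _ _ _ (fun x y => f x = y)) => [x Ax|x x' y <-].
  by exists (f x).
by move=> /injf.
Qed.

Lemma small_finite (T : Type) (A : set T) : finite_set A -> small A.
Proof. by move=> finA KA; apply: regK.1; apply: card_le_finite KA finA. Qed.

(** An injection of [K] into the union would pull the pieces back to fewer than tau small sets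
    covering [K], against regularity. *)
Lemma small_bigcup (I T : Type) (D : set I) (F : I -> set T) :
  small D -> (forall i, D i -> small (F i)) -> small (\bigcup_(i in D) F i).
Proof.
move=> smD smF /card_leT_inj[f finj fP].
have := regK.2 [set f @^-1` (F i) | i in D].
apply.
- by apply: small_card_lt; apply: small_image.
- move=> _ [i Di <-]; apply: small_card_lt; apply: small_preimage => //.
  exact: smF.
- apply/seteqP; split=> // k _; have [i Di Fi] := fP k.
  by exists (f @^-1` F i) => //; exists i.
Qed.

Lemma small_setX (T U : Type) (A : set T) (B : set U) :
  small A -> small B -> small (A `*` B).
Proof.
move=> smA smB.
apply: (@small_subset _ _ (\bigcup_(a in A) (pair a @` B))).
  by move=> [a b] [/= Aa Bb]; exists a => //; exists b.
by apply: small_bigcup => // a _; apply: small_image.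
Qed.

(* The projection h only serves to bound the size of the sequences when S is
   finite; for infinite S every size is allowed, and nat is small. *)
Lemma small_uniq_seq (T : Type) (E : eqType) (h : T -> E) (S : pred T) :
  small [set x | S x] -> small [set s : seq T | uniq (map h s) && all S s].
Proof.
move=> smS.
pose sizes := [set n | exists2 s : seq T, uniq (map h s) && all S s & size s = n].
apply: (@small_subset _ _
  (\bigcup_(n in sizes) [set s : seq T | size s = n /\ all S s])).
  by move=> s us; exists (size s); [exists s|split=> //; case/andP: us].
apply: small_bigcup => [|n _].
  have [finS|/infiniteP infS] := pselect (finite_set [set x | S x]).
    have /finite_seqP[t hSt] := finite_image h finS.
    apply: small_finite; apply: (@sub_finite_set _ _ `I_(size t).+1) => //.
    move=> _ [s /andP[us Ss] <-] /=; rewrite ltnS -(size_map h).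
    apply: uniq_leq_size us _; elim: s Ss => [//|x s IHs] /= /andP[Sx Ss] y.
    rewrite inE => /orP[/eqP ->|]; last exact: IHs.
    by have : (h @` [set x | S x]) (h x) by [exists x]; rewrite hSt.
  move=> Ksizes; apply: smS.
  exact: card_le_trans (card_le_trans Ksizes (card_leT _)) infS.
elim: n => [|n IHn].
  apply: (@small_subset _ _ [set [::]]) => [s [/size0nil ->]//|].
  by apply: small_finite; apply: finite_set1.
apply: (@small_subset _ _
  ((fun p => p.1 :: p.2) @` ([set x | S x] `*` [set s | size s = n /\ all S s]))).
  by move=> [|x s] [//= [<-]] /andP[Sx Ss]; exists (x, s).
by apply: small_image; apply: small_setX.
Qed.

(* K is ordered like its initial ordinal: if the segments of some well-order of
   K are not all small, K embeds into the least segment that is not. *)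
Lemma initial_well_order : exists le : rel K,
  [/\ total le, transitive le, antisymmetric le,
      well_founded (fun x y => ~~ le y x) & forall y, small [set x | le x y]].
Proof.
have [R woR] := well_ordering_principle {classic K}.
suff [f injf smf] : exists2 f : K -> {classic K}, injective f &
    forall y, small [set x | R x (f y)].
  exists (fun x y => R (f x) (f y)); split.
  - by move=> x y; apply: well_order_total.
  - by move=> y x z; apply: well_order_trans.
  - by move=> x y /(well_order_antisymmetric woR)/injf.
  - move=> x; have [z fxz] : exists z, f x = z by exists (f x).
    elim: z / (well_order_wf woR z) x fxz => z _ IHz x fxz.
    by constructor=> y; rewrite fxz => /IHz; apply.
  - by move=> y; apply: (@small_preimage _ _ f [set x | R x (f y)]).
have [smR|nsmR] := pselect (forall y, small [set x | R x y]).
  by exists id => // x; apply: smR.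
have [|z [[/asboolP nz minz] _]] := woR [pred y | `[< ~ small [set x | R x y] >]].
  by move/existsNP: nsmR => [y ?]; exists y; apply/asboolP.
have : ~ small [set x | R x z /\ x <> z].
  apply: contra_not nz => smz.
  apply: (@small_subset _ _ (\bigcup_(b in [set: bool])
    (if b then [set z] else [set x | R x z /\ x <> z]))).
    by move=> x Rxz; have [->|xz] := pselect (x = z); [exists true|exists false].
  apply: small_bigcup => [|[] _ //]; first exact/small_finite/finite_finset.
  exact/small_finite/finite_set1.
move=> /contrapT/card_leT_inj[f injf fz]; exists f => // y.
have [Ryz yz] := fz y; apply: contrapT => nsm; apply: yz.
apply: (well_order_antisymmetric woR); rewrite Ryz /=.
by apply: minz; apply/asboolP.
Qed.

(** Regularity in the form of cofinality: were the values unbounded, [K] would be a small union of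
    small initial segments. *)
Lemma small_strict_bound (le : rel K) (I : Type) (D : set I) (f : I -> K) :
  (forall y, small [set x | le x y]) -> small D ->
  exists d, forall i, D i -> ~~ le d (f i).
Proof.
move=> smle smD; apply: contrapT => /forallNP unb.
apply: (small_bigcup (F := fun i => [set x | le x (f i)]) smD) => //.
apply: subset_card_le => d _.
by have /existsNP[i /not_implyP[Di /negP/negPn ledi]] := unb d; exists i.
Qed.

End Small.

(** * Functions given by words, and closedness of algebraic sets *)

Section WordFunctions.
Variable G : groupType.
Implicit Types phi psi : G -> G.

Definition word_function phi := exists w, forall x, word_subst w x = phi x.

Lemma word_functionC (c : G) : word_function (fun=> c).
Proof. by exists [:: Const c] => x; rewrite /word_subst big_seq1. Qed.

Lemma word_function_id : word_function id.
Proof. by exists [:: Var G] => x; rewrite /word_subst big_seq1. Qed.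

Lemma word_functionM phi psi : word_function phi -> word_function psi ->
  word_function (fun x => phi x * psi x).
Proof.
move=> [v vE] [w wE]; exists (v ++ w) => x.
by rewrite -vE -wE /word_subst big_cat.
Qed.

Lemma word_functionV phi : word_function phi ->
  word_function (fun x => (phi x)^-1).
Proof.
move=> [w wE]; suff [v vE] : word_function (fun x => (word_subst w x)^-1).
  by exists v => x; rewrite vE wE.
elim: w {phi wE} => [|l w [v vE]].
  by exists [::] => x; rewrite /word_subst !big_nil invg1.
exists (v ++ [:: match l with
  Const c => Const c^-1 | Var => VarInv G | VarInv => Var G end]).
move=> x; rewrite {2}/word_subst big_cons invgM -vE /word_subst big_cat big_seq1.
by case: l => [c||] //=; rewrite invgK.
Qed.

Lemma elementary_algebraic_eq phi psi : word_function phi ->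
  word_function psi -> elementary_algebraic [set x | phi x = psi x].
Proof.
move=> wphi wpsi.
have [w wE] := word_functionM wphi (word_functionV wpsi).
exists w; apply/seteqP; split=> x /=; rewrite wE; first by move=> ->; apply: mulgV.
exact: divg1_eq.
Qed.

(** Words evaluate continuously, so elementary algebraic sets are preimages of the closed set
    [[set 1]]. In a P_tau-topology a union of fewer than tau closed sets is closed. *)
Lemma algebraic_unconditionally_closed (K : Type) (A : set G) :
  algebraic K A -> unconditionally_closed K A.
Proof.
move=> [F [Falg ->]] t X [contM contV] hausX PX.
have contw w : continuous (word_subst w : X -> X).
  elim: w => [|l w IHw] x.
    rewrite (_ : word_subst [::] = fun=> 1); first exact: (@cvg_cst X _ X (nbhs (x : X))).
    by apply/funext => y; rewrite /word_subst big_nil.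
  rewrite (_ : word_subst (l :: w) =
      fun y => letter_subst y l * word_subst w y); last first.
    by apply/funext => y; rewrite /word_subst big_cons.
  have := @continuous2_cvg X X X X (nbhs (x : X)) _ (fun y => letter_subst y l)
    (word_subst w) (fun a b : X => (a : G) * (b : G))
    (letter_subst x l) (word_subst w x)
    (contM (letter_subst x l, word_subst w x)).
  apply; last exact: IHw.
  case: l => [c||] /=; last exact: contV.
    exact: (@cvg_cst X c X (nbhs (x : X))).
  exact: cvg_id.
have closed_elem B : elementary_algebraic B -> closed (B : set X).
  move=> [w ->]; apply: (@preimage_closed X X (word_subst w) [set (1 : G)]).
    by move=> x _; apply: contw.
  exact: (accessible_closed_set1 (hausdorff_accessible hausX)).
apply: closed_bigI => B /Falg[H [ltH elemH ->]].
rewrite -openC setC_bigcup; have := PX [set ~` C | C in H].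
rewrite bigcap_image; apply.
  split; first exact: card_le_trans (card_image_le _ _) ltH.1.
  by move=> KH; apply: ltH.2; apply: card_le_trans KH (card_image_le _ _).
by move=> _ [C HC <-]; rewrite openC; apply: closed_elem; apply: elemH.
Qed.

End WordFunctions.

(** * The group P_tau-topology defined by a base at the identity *)

Section NeighborhoodBase.
Variables (K : Type) (regK : infinite_regular K) (G : groupType).
Variables (I : Type) (U : I -> set G).
Hypothesis U1 : forall i, U i 1.
Hypothesis UI : forall D : set I, small K D ->
  exists j, forall i, D i -> U j `<=` U i.
Hypothesis UM : forall i, exists j, forall x y, U j x -> U j y -> U i (x * y).
Hypothesis UV : forall i x, U i x -> U i x^-1.
Hypothesis UJ : forall g i, exists j, forall x, U j x -> U i (x ^ g).

Definition base_open (A : set G) :=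
  forall x, A x -> exists i, forall y, U i y -> A (x * y).

Lemma base_openT : base_open setT.
Proof.
have [j _] := UI (small_finite regK (finite_set0 I)).
by move=> x _; exists j.
Qed.

Lemma base_open_bigcap (F : set (set G)) : small K F -> F `<=` base_open ->
  base_open (\bigcap_(B in F) B).
Proof.
move=> smF Fopen x Fx.
have [f fP] : exists f : set G -> I, forall B, F B -> forall y, U (f B) y -> B (x * y).
  have [i0 _] := UI (small_finite regK (finite_set0 I)).
  (* The index [i0] is a default for sets outside [F]. *)
  have /choice[f fP] : forall B, exists i, F B -> forall y, U i y -> B (x * y).
    move=> B; have [FB|nFB] := pselect (F B); last by exists i0.
    by have [i iP] := Fopen B FB x (Fx B FB); exists i.
  by exists f.
have [j jP] := UI (small_image (f := f) smF).
exists j => y Uy B FB; apply: fP => //; apply: jP Uy.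
by exists B.
Qed.

Lemma base_openI : setI_closed base_open.
Proof.
move=> A B oA oB.
rewrite (_ : A `&` B = \bigcap_(C in [set A; B]) C).
  apply: base_open_bigcap; first exact/(small_finite regK)/finite_set2.
  by move=> C [->|->].
by rewrite bigcap_setU !bigcap_set1.
Qed.

Lemma base_open_bigcup (J : Type) (f : J -> set G) :
  (forall j, base_open (f j)) -> base_open (\bigcup_j f j).
Proof.
move=> fo x [j _ /fo[i iP]]; exists i => y Uy.
by exists j => //; apply: iP.
Qed.

Definition base_space : topologicalType := HB.pack_for topologicalType G
  (isOpenTopological.Build G base_openT base_openI base_open_bigcup).

Lemma base_nbhsE (x : G) (A : set G) : nbhs (x : base_space) (A : set base_space) <->
  exists i, forall y, U i y -> A (x * y).
Proof.
split=> [[B [oB Bx BA]]|[i iA]].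
  by have [i iP] := oB x Bx; exists i => y /iP /BA.
(* The witness is the interior of [A]; [UM] makes it open. *)
exists [set y | exists j, forall z, U j z -> A (y * z)]; split.
- move=> y [j jA]; have [k kj] := UM j; exists k => z Uz.
  by exists k => u Uu; rewrite -mulgA; apply: jA; apply: kj.
- by exists i.
- by move=> y [j /(_ _ (U1 j))]; rewrite mulg1.
Qed.

Lemma base_group_topology : group_topology (Topological.class base_space).
Proof.
split=> [[x y]|x] A /base_nbhsE /=[i iA].
  have [j ji] := UM i; have [k kj] := UJ y j.
  exists ([set z | exists2 u, U k u & z = x * u], [set z | exists2 u, U j u & z = y * u]) => /=.
    by split; apply/base_nbhsE; [exists k|exists j] => u Uu; exists u.
  move=> [_ _] [/= [u Uu ->] [v Uv ->]].
  (* Moving [y] to the left past [u] conjugates [u], which the choice of [k] by [UJ] absorbs. *)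
  rewrite /= (_ : x * u * (y * v) = x * y * (u ^ y * v)).
    by apply: iA; apply: ji => //; apply: kj.
  by rewrite conjgE !mulgA mulgK.
apply/base_nbhsE; have [j ji] := UJ x^-1 i; exists j => y Uy.
rewrite /= invgM (_ : y^-1 * x^-1 = x^-1 * (y^-1) ^ x^-1).
  by apply: iA; apply: ji; apply: UV.
by rewrite conjgE invgK !mulgA mulVg mul1g.
Qed.

Lemma base_P_topology : P_topology K base_space.
Proof. by move=> F [_ smF]; apply: base_open_bigcap. Qed.

(** If [U j] times itself lies in [U i], a common point of the translates of [U j] by [x] and [y]
    puts [x^-1 * y] in [U i]. *)
Lemma base_hausdorff : (forall g, g <> 1 -> exists i, ~ U i g) ->
  hausdorff_space base_space.
Proof.
move=> sepU x y clxy; apply: contrapT => xy.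
have [|i] := sepU (x^-1 * y); first by move=> /mulg1_eq; rewrite invgK => /xy.
have [j ji] := UM i; apply.
have [||z [[u Uu ->] [v Uv]]] := clxy [set z | exists2 u, U j u & z = x * u]
    [set z | exists2 u, U j u & z = y * u].
- by apply/base_nbhsE; exists j => u Uu; exists u.
- by apply/base_nbhsE; exists j => u Uu; exists u.
move=> xuyv; rewrite (_ : x^-1 * y = u * v^-1); first by apply: ji => //; apply: UV.
by rewrite -[u](mulKg x) xuyv !mulgA mulgK.
Qed.

End NeighborhoodBase.

(** Transfinite dependent choice: the value at [b] is chosen knowing only the values strictly below
    [b]. The default [t0] fills in the rest, so that [R] can take a total function. *)
Lemma wf_choice (K T : Type) (le : rel K) (t0 : T) (R : K -> (K -> T) -> T -> Prop) :
  well_founded (fun x y => ~~ le y x) -> (forall b f, exists x, R b f x) ->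
  exists f, forall b, R b (fun c => if le b c then t0 else f c) (f b).
Proof.
move=> wf exR.
have /choice[c cP] : forall p, exists x, R p.1 p.2 x by move=> p; apply: exR.
pose restr b (prev : forall d, ~~ le b d -> T) d :=
  if @idP (~~ le b d) is ReflectT p then prev d p else t0.
pose f := Fix wf (fun=> T) (fun b prev => c (b, restr b prev)).
exists f => b; rewrite {2}/f Fix_eq.
  rewrite -/f; move: (cP (b, restr b (fun d _ => f d))) => /=.
  congr (R b _ _); apply/funext => d; rewrite /restr.
  by case: {-}_ / idP => [/negPf ->|/negP/negPn ->].
move=> x g h gh; congr (c (x, _)); apply/funext => d; rewrite /restr.
by case: {-}_ / idP => // p; apply: gh.
Qed.

(** * The topology in which a generic sequence converges to the identity *)

Section ConvergentSequence.
Variables (K : Type) (regK : infinite_regular K) (le : rel K).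
Hypotheses (le_total : total le) (le_trans : transitive le).
Hypothesis le_anti : antisymmetric le.
Hypothesis small_le : forall y, small K [set x | le x y].
Variables (iota : nat -> K) (iota_inj : injective iota).
Variables (G : groupType) (rep : K -> G) (cls : G -> K).
Hypothesis clsP : forall g x : G, x ^ rep (cls g) = x ^ g.

(* ((n, k), (c, e)) stands for the conjugate by rep k of the c-th term of the
   sequence, or of its inverse if e is false; n is a tag. *)
Definition factor : Type := (nat * K) * (K * bool).

Definition factor_eval (a : K -> G) (t : factor) : G :=
  (if t.2.2 then a t.2.1 else (a t.2.1)^-1) ^ rep t.1.2.

Definition eval (a : K -> G) (s : seq factor) : G :=
  \prod_(t <- s) factor_eval a t.

(* The base at 1 of the finest group P_tau-topology in which a converges to 1.
   Since the tags are distinct, splitting them by parity gives for every F some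
   F' with nbh a F' * nbh a F' `<=` nbh a F. *)
Definition nbh (a : K -> G) (F : nat -> K -> K) : set G :=
  [set x | exists s, [/\ uniq [seq t.1.1 | t <- s],
    all (fun t : factor => le (F t.1.1 t.1.2) t.2.1) s & x = eval a s]].

Let lerefl x : le x x.
Proof. by rewrite -[le x x]orbb le_total. Qed.

Let ltW x y : ~~ le y x -> le x y.
Proof. by move/negPf => nyx; have := le_total x y; rewrite nyx orbF. Qed.

Lemma eval_cat a s1 s2 : eval a (s1 ++ s2) = eval a s1 * eval a s2.
Proof. by rewrite /eval big_cat. Qed.

Lemma eval_cons a t s : eval a (t :: s) = factor_eval a t * eval a s.
Proof. by rewrite /eval big_cons. Qed.

Lemma eval_nil a : eval a [::] = 1.
Proof. by rewrite /eval big_nil. Qed.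

Lemma nbh1 a F : nbh a F 1.
Proof. by exists [::]; rewrite eval_nil. Qed.

Lemma nbh_le a F F' : (forall n k, le (F n k) (F' n k)) ->
  nbh a F' `<=` nbh a F.
Proof.
move=> FF' _ [s [us Fs ->]]; exists s; split=> //.
by apply: sub_all Fs => t; apply: le_trans (FF' _ _).
Qed.

(** By regularity fewer than tau functions have a pointwise upper bound, and [nbh a F] shrinks as
    [F] grows. *)
Lemma nbh_bigcap a (D : set (nat -> K -> K)) : small K D ->
  exists F', forall F, D F -> nbh a F' `<=` nbh a F.
Proof.
move=> smD.
have /choice[b bP] : forall p : (nat * K)%type, exists d,
    forall F, D F -> ~~ le d (F p.1 p.2).
  by move=> p; apply: small_strict_bound smD.
exists (fun n k => b (n, k)) => F DF; apply: nbh_le => n k.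
by apply: ltW; apply: (bP (n, k)).
Qed.

Lemma nbh_mul a F : exists F', forall x y, nbh a F' x -> nbh a F' y ->
  nbh a F (x * y).
Proof.
pose F0 n := F n.*2; pose F1 n := F n.*2.+1.
have [|F' F'P] := @nbh_bigcap a [set F0; F1].
  exact/(small_finite regK)/finite_set2.
have /F'P sub0 : [set F0; F1] F0 by left.
have /F'P sub1 : [set F0; F1] F1 by right.
pose retag (h : nat -> nat) (t : factor) : factor := ((h t.1.1, t.1.2), t.2).
have eval_retag h s : eval a (map (retag h) s) = eval a s.
  by rewrite /eval big_map.
exists F' => x y /sub0[s [us Fs ->]] /sub1[r [ur Fr ->]].
exists (map (retag double) s ++ map (retag (fun n => n.*2.+1)) r); split.
- rewrite map_cat -!map_comp cat_uniq.
  rewrite (map_comp double (fun t : factor => t.1.1)).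
  rewrite (map_comp (fun n => n.*2.+1) (fun t : factor => t.1.1)).
  rewrite !map_inj_uniq ?us ?ur ?andbT //=; first last.
  + exact: double_inj.
  + by move=> m n [] /double_inj.
  apply/hasPn => _ /mapP[n _ ->]; apply/mapP => -[m _] /(congr1 odd) /=.
  by rewrite !odd_double.
- by rewrite all_cat !all_map; apply/andP.
- by rewrite eval_cat !eval_retag.
Qed.

Lemma nbhV a F x : nbh a F x -> nbh a F x^-1.
Proof.
move=> [s [us Fs ->]].
pose flip (t : factor) : factor := (t.1, (t.2.1, ~~ t.2.2)).
exists (rev (map flip s)); split.
- by rewrite map_rev rev_uniq -map_comp.
- by rewrite all_rev all_map.
- elim: s {us Fs} => [|t s IHs]; first by rewrite eval_nil invg1.
  rewrite eval_cons invgM IHs /= rev_cons -cats1 eval_cat; congr (_ * _).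
  rewrite eval_cons eval_nil mulg1 /factor_eval /= -conjVg.
  by case: t.2.2; rewrite ?invgK.
Qed.

Lemma nbhJ a F g : exists F', forall x, nbh a F' x -> nbh a F (x ^ g).
Proof.
(* Conjugation by [g] keeps tags and positions and turns the conjugator [rep k] into [rep k * g], so
   [F] has to be read at the class of the latter. *)
exists (fun n k => F n (cls (rep k * g))) => _ [s [us Fs ->]].
pose conj (t : factor) : factor := ((t.1.1, cls (rep t.1.2 * g)), t.2).
exists (map conj s); split; [by rewrite -map_comp|by rewrite all_map|].
elim: s {us Fs} => [|t s IHs]; first by rewrite eval_nil conj1g.
by rewrite /= !eval_cons conjMg IHs /factor_eval /= clsP conjgM.
Qed.

Lemma nbh_sequence a F : exists c, nbh a F (a c).
Proof.
(* A single factor with tag 0 and trivial conjugation, at the first position that [F] allows. *)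
exists (F 0 (cls 1)), [:: ((0, cls 1), (F 0 (cls 1), true))].
by rewrite /= lerefl eval_cons eval_nil mulg1 /factor_eval /= clsP conjg1.
Qed.

(** For [x := f b] this agrees with [f] up to [b]; for [x := 1] it erases all terms from [b] on. *)
Definition update_above (b : K) (f : K -> G) (x : G) : K -> G :=
  fun c => if le b c then x else f c.

(** The products of complexity bounded by [b]. Tags are measured in [K] through [iota], and their
    distinctness limits the length. *)
Definition bounded_seqs (b : K) : set (seq factor) :=
  [set s | uniq [seq t.1.1 | t <- s] &&
    all (fun t : factor => [&& le (iota t.1.1) b, le t.1.2 b & le t.2.1 b]) s].

Lemma small_bounded_seqs b : small K (bounded_seqs b).
Proof.
apply: small_uniq_seq => //.
apply: (@small_subset _ _ _ (([set n | le (iota n) b] `*` [set k | le k b]) `*`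
    ([set c | le c b] `*` [set: bool]))).
  by move=> [[n k] [c e]] /= /and3P[].
apply: small_setX => //; apply: small_setX => //.
  exact: (small_preimage (A := [set k | le k b]) iota_inj).
exact/(small_finite regK)/finite_finset.
Qed.

(** Markov's condition: [x] solves no bounded equation that 1 does not solve. The second side [s']
    serves to express a fixed group element. *)
Definition generic (b : K) (f : K -> G) (x : G) : Prop :=
  forall s s', bounded_seqs b s -> bounded_seqs b s' ->
    eval (update_above b f x) s = eval (update_above b f x) s' ->
    eval (update_above b f 1) s = eval (update_above b f 1) s'.

Lemma exists_generic (A : set G) (g : G) b f :
  (forall B, additively_algebraic K B -> A `<=` B -> B g) ->
  exists2 x, A x & generic b f (g^-1 * x).
Proof.
move=> Ag.
pose E (p : seq factor * seq factor) := [set x : G |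
  eval (update_above b f (g^-1 * x)) p.1 = eval (update_above b f (g^-1 * x)) p.2].
pose D := [set p | [/\ bounded_seqs b p.1, bounded_seqs b p.2 &
  eval (update_above b f 1) p.1 <> eval (update_above b f 1) p.2]].
have addE : additively_algebraic K (\bigcup_(B in E @` D) B).
  exists (E @` D); split=> //.
    apply: small_card_lt; apply: small_image.
    apply: (@small_subset _ _ _ (bounded_seqs b `*` bounded_seqs b)).
      by move=> p [].
    by apply: small_setX => //; apply: small_bounded_seqs.
  have wordE s : word_function (fun x => eval (update_above b f (g^-1 * x)) s).
    have wordx c : word_function (fun x => update_above b f (g^-1 * x) c).
      rewrite /update_above; case: (le b c); last exact: word_functionC.
      exact: word_functionM (word_functionC _) (word_function_id _).
    elim: s => [|t s [w wE]].
      have [w wE] := word_functionC (1 : G).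
      by exists w => x; rewrite wE eval_nil.
    suff [v vE] : word_function (fun x =>
        factor_eval (update_above b f (g^-1 * x)) t).
      by exists (v ++ w) => x; rewrite eval_cons -vE -wE /word_subst big_cat.
    rewrite /factor_eval; case: t.2.2.
      apply: word_functionM (word_functionC _) _.
      exact: word_functionM (wordx _) (word_functionC _).
    apply: word_functionM (word_functionC _) _.
    exact: word_functionM (word_functionV (wordx _)) (word_functionC _).
  by move=> _ [p _ <-]; apply: elementary_algebraic_eq.
have /existsNP[x /not_implyP[Ax Ex]] : ~ (A `<=` \bigcup_(B in E @` D) B).
  (* Otherwise [g] would solve an equation indexed by [D]; as [g^-1 * g] is 1, this contradicts the
     definition of [D]. *)
  move=> /(Ag _ addE)[_ [p [_ _ Dp] <-]].
  by rewrite /E /= mulVg => /Dp.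
exists x => // s s' bs bs' ss'; apply: contrapT => ns.
by apply: Ex; exists (E (s, s')) => //; exists (s, s').
Qed.

(** Genericity at [b] ignores the values of [f] from [b] on, so the default values of the recursion
    can be exchanged for the actual sequence. *)
Lemma generic_eq b f f' x : (forall c, ~~ le b c -> f c = f' c) ->
  generic b f x -> generic b f' x.
Proof.
move=> ff'; have upd y : update_above b f y = update_above b f' y.
  apply/funext => c; rewrite /update_above.
  by case: (boolP (le b c)) => // /ff'.
by move=> gen s s' bs bs'; rewrite -!upd; apply: gen.
Qed.

Lemma eval_eq_in (P : pred K) f f' s : (forall c, P c -> f c = f' c) ->
  all (fun t : factor => P t.2.1) s -> eval f s = eval f' s.
Proof.
move=> ff'; elim: s => [|t s IHs]; first by rewrite !eval_nil.
move=> /= /andP[Pt /IHs IH]; rewrite !eval_cons IH; congr (_ * _).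
by rewrite /factor_eval ff'.
Qed.

Lemma eval_update1 b f s : eval (update_above b f 1) s =
  eval f [seq t <- s | ~~ le b t.2.1].
Proof.
elim: s => [|t s IHs]; first by rewrite !eval_nil.
rewrite /= eval_cons {}IHs {1}/factor_eval /update_above.
case: (boolP (le b _)) => bt /=; first by rewrite invg1 if_same conj1g mul1g.
by rewrite eval_cons.
Qed.

Lemma exists_strict_bound (s : seq K) : exists d, all (fun c => ~~ le d c) s.
Proof.
have [d dP] := small_strict_bound regK id small_le
  (small_finite regK (finite_seq (s : seq {classic K}))).
by exists d; apply/(@allP {classic K}).
Qed.

Lemma exists_max_position (t : factor) s : exists b,
  all (fun u : factor => le u.2.1 b) (t :: s) &&
  has (fun u : factor => le b u.2.1) (t :: s).
Proof.
elim: s t => [|u s IHs] t; first by exists t.2.1; rewrite /= lerefl.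
have [b /andP[sb bs]] := IHs u.
have [tb|bt] := orP (le_total t.2.1 b).
  by exists b; move: sb bs; rewrite /= tb => -> ->; rewrite orbT.
exists t.2.1; apply/andP; split; last by rewrite /= lerefl.
rewrite /= lerefl; apply: sub_all sb => v vb.
exact: le_trans vb bt.
Qed.

(** Fix a product [s'] for [h], with all data below [d], and let [F] dominate [d]. If a product [s]
    for [h] obeys [F] and has highest position [b], genericity at [b] applies to the equation
    between [s] and [s']. Setting the terms at [b] to 1 leaves [s'] intact and shortens [s]; the
    descent ends at the empty product, where [h] would be 1. *)
Lemma nbh_separated a : (forall b, generic b a (a b)) ->
  forall h, h <> 1 -> exists F, ~ nbh a F h.
Proof.
move=> gena h h1.
have [[s' [us' hs']]|/forallNP nh] := pselect (exists s',
    uniq [seq t.1.1 | t <- s' : seq factor] /\ h = eval a s'); last first.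
  by exists (fun _ k => k) => -[s' [us' _ hs']]; apply: (nh s').
have [d] := exists_strict_bound ([seq iota t.1.1 | t <- s'] ++
  [seq t.1.2 | t <- s'] ++ [seq t.2.1 | t <- s']).
rewrite !all_cat !all_map => /and3P[d1 d2 d3].
(* Dominating tag and conjugator as well puts them below the position of their factor, hence below
   [b]: every [s] obeying [F] is then a bounded sequence. *)
have /choice[F FP] : forall p : (nat * K)%type, exists c,
    [/\ le d c, le (iota p.1) c & le p.2 c].
  move=> p; have [c /and4P[/ltW ? /ltW ? /ltW ? _]] :=
    exists_strict_bound [:: d; iota p.1; p.2].
  by exists c.
exists (fun n k => F (n, k)) => -[s [us Fs hs]].
have [m] := ubnP (size s); elim: m => // m IHm in s us Fs hs *.
case: s us Fs hs => [|t s] us Fs hs; first by rewrite eval_nil in hs.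
have [b /andP[sb bs]] := exists_max_position t s.
set s0 := t :: s in us Fs hs sb bs * => sm.
have db : le d b.
  move: Fs sb => /= /andP[Ft _] /andP[tb _].
  have [dF _ _] := FP t.1; apply: le_trans tb; apply: le_trans dF _.
  by move: Ft; rewrite -surjective_pairing.
have ltdb c : ~~ le d c -> ~~ le b c.
  by apply: contra => bc; apply: le_trans bc.
have eval_s' x : eval (update_above b a x) s' = h.
  rewrite hs'; apply: (eval_eq_in (P := fun c => ~~ le d c)) d3 => c /ltdb /negPf bc.
  by rewrite /update_above bc.
have eval_s0 : eval (update_above b a (a b)) s0 = eval a s0.
  apply: (eval_eq_in (P := le^~ b)) sb => c cb; rewrite /update_above.
  by case: ifP => // bc; congr (a _); apply: le_anti; rewrite bc cb.
have := gena b s0 s'; rewrite eval_s0 !eval_s' eval_update1 => gen.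
apply: (IHm [seq u <- s0 | ~~ le b u.2.1]).
- by rewrite filter_mask map_mask mask_uniq.
- by rewrite all_filter; apply: sub_all Fs => u Fu; apply/implyP.
- symmetry; apply: gen => //.
  + apply/andP; split=> //.
    have : all (predI (fun u : factor => le (F (u.1.1, u.1.2)) u.2.1)
        (fun u : factor => le u.2.1 b)) s0 by rewrite all_predI Fs sb.
    apply: sub_all => u /andP[Fu ub]; have [_ i1 i2] := FP (u.1.1, u.1.2).
    by rewrite ub (le_trans i1) ?(le_trans i2) // (le_trans Fu).
  + apply/andP; split=> //.
    have : all (predI (fun u : factor => ~~ le d (iota u.1.1))
      (predI (fun u : factor => ~~ le d u.1.2)
      (fun u : factor => ~~ le d u.2.1))) s' by rewrite !all_predI d1 d2 d3.
    by apply: sub_all => u /and3P[/ltdb/ltW -> /ltdb/ltW -> /ltdb/ltW ->].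
(* The filter drops at least one factor, since the position [b] is attained. *)
- rewrite -ltnS; apply: leq_trans sm; rewrite ltnS size_filter.
  by rewrite -(count_predC (fun u : factor => le b u.2.1) s0) -addn1 addnC leq_add2r
    -has_count.
Qed.

End ConvergentSequence.

(** * Conjugation modulo the center, and the harder implication *)

Lemma center_transversal (K : Type) (G : groupType) :
  center_cosets G #<= [set: K] ->
  exists (rep : K -> G) (cls : G -> K), forall g x : G, x ^ rep (cls g) = x ^ g.
Proof.
move=> /card_leP/injfunPex[phi _ phi_inj].
pose coset (g : G) := [set g * z | z in group_center G].
have cosetP g : center_cosets G (coset g) by exists g.
pose cls g : K := val (phi (SigSub (mem_set (cosetP g)))).
have /choice[rep repP] : forall k, exists g', (exists g, cls g = k) -> cls g' = k.
  move=> k; have [[g gk]|nk] := pselect (exists g, cls g = k); first by exists g.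
  by exists 1.
exists rep, cls => g x.
have : cls (rep (cls g)) = cls g by apply: repP; exists g.
move=> /val_inj /phi_inj; rewrite !inE => /(_ Logic.I Logic.I) /(congr1 val) /= Eg.
have : coset (rep (cls g)) (rep (cls g)).
  by exists 1; [move=> y; apply/commute_sym/commute1|rewrite mulg1].
(* Two elements of one coset differ by a central factor [z], and conjugation by [z] is trivial. *)
rewrite Eg => -[z zZ <-]; rewrite conjgM; apply/conjg_fixP/commgP/commute_sym.
exact: zZ.
Qed.

Lemma unconditionally_closed_algebraic (K : Type) (regK : infinite_regular K)
  (G : groupType) (centerG : center_cosets G #<= [set: K]) (A : set G) :
  unconditionally_closed K A -> algebraic K A.
Proof.
move=> closedA.
(* The tau-Zariski closure of [A]: all additively algebraic sets containing it. *)
exists [set B | additively_algebraic K B /\ A `<=` B]; split=> [B []//|].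
apply/seteqP; split=> [x Ax B [_ AB]|g gA]; first exact: AB.
apply: contrapT => nAg.
have {}gA B : additively_algebraic K B -> A `<=` B -> B g.
  by move=> addB AB; apply: gA.
have [le [le_total le_trans le_anti le_wf small_le]] := initial_well_order regK.
have /infiniteP/card_leT_inj[iota iota_inj _] := regK.1.
have [rep [cls clsP]] := center_transversal centerG.
(* The recursion builds the points of [A] themselves; genericity concerns their translates by
   [g^-1]. *)
pose R b (f : K -> G) x := A x /\
  generic le iota rep b (fun c => g^-1 * f c) (g^-1 * x).
have [|x xP] := @wf_choice _ _ le 1 R le_wf.
  move=> b f.
  have [x Ax genx] := exists_generic regK small_le iota_inj rep b
    (fun c => g^-1 * f c) gA.
  by exists x.
pose a c := g^-1 * x c.
have gena b : generic le iota rep b a (a b).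
  by have [_] := xP b; apply: generic_eq => c /negPf ->.
pose U := nbh le rep a.
have U1 F : U F 1 by apply: nbh1.
have UI D : small K D -> exists F', forall F, D F -> U F' `<=` U F.
  exact: nbh_bigcap.
have UM F : exists F', forall y z, U F' y -> U F' z -> U F (y * z).
  exact: nbh_mul.
have UV F y : U F y -> U F y^-1 by apply: nbhV.
have UJ h F : exists F', forall y, U F' y -> U F (y ^ h) by exact: nbhJ clsP a F h.
pose X := base_space regK UI.
have := closedA (Topological.class X) (base_group_topology regK U1 UI UM UV UJ).
have hausX : hausdorff_space X.
  apply: base_hausdorff => // h.
  exact: (nbh_separated regK le_total le_trans le_anti small_le).
move=> /(_ hausX (@base_P_topology K regK G _ U UI)) closedXA; apply: nAg.
apply: closedXA => B /(base_nbhsE regK U1 UI UM)[F FB].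
(* The basic neighborhood of [g] given by [F] contains [g * a c], which is the point [x c] of
   [A]. *)
have [c Uac] := nbh_sequence le_total clsP a F.
exists (x c); split; first by have [] := xP c.
by rewrite -[x c](mulVKg g); apply: FB.
Qed.

Theorem corollary3 (K : Type) (regK : infinite_regular K)
  (G : groupType) (centerG : center_cosets G #<= [set: K]) (A : set G) :
  algebraic K A <-> unconditionally_closed K A.
Proof.
split; first exact: algebraic_unconditionally_closed.
exact: unconditionally_closed_algebraic.
Qed.
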